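(* Let $p\geq 7$ be a prime number. Then there are, up to isomorphism, 3 left braces with additive group $\mathbf{Z}_p\times(C_6\times C_2)$ and multiplicative group a semidirect product $\mathbf{Z}_p\rtimes D_{2\cdot 6}$. Among these, one of them is a direct product, one has cyclic kernel of order 6 and the other one has kernel isomorphic to $D_{2\cdot 3}$.
   Context: A left brace is a set $B$ with operations $+,\cdot$ such that $(B,+)$ is an abelian group (additive group), $(B,\cdot)$ is a group (multiplicative group), and $a(b+c)=ab-a+ac$ for all $a,b,c\in B$. Isomorphisms are bijections preserving both operations. $\mathbf{Z}_m=\mathbf{Z}/m\mathbf{Z}$, $C_m$ is the cyclic group of order $m$, and $D_{2\cdot m}$ is the dihedral group of order $2m$. Given a left brace $B'$ of size 12 with multiplicative group $F$ and a group morphism $\tau:F\to\mathrm{Aut}(\mathbf{Z}_p)\simeq\mathbf{Z}_p^*$, the semidirect product of the trivial brace $\mathbf{Z}_p$ (with $a\cdot b=a+b$) and $B'$ via $\tau$ is $\mathbf{Z}_p\times B'$ with componentwise addition and $(a,b)\cdot(a',b')=(a+\tau(b)a',bb')$; it is the direct product of braces when $\tau$ is trivial. For $p\geq 7$ every left brace of size $12p$ is isomorphic to one of this form. The kernel of the brace means $\ker\tau\subseteq F$. ''Multiplicative group $\mathbf{Z}_p\rtimes F$'' means isomorphic to $\mathbf{Z}_p\rtimes_\tau F$ for some $\tau$, possibly trivial. *)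

(* Defs.v *)
From HB Require Import structures.
From mathcomp Require Import all_boot all_order all_algebra all_fingroup all_solvable.

Set Implicit Arguments.
Unset Strict Implicit.
Unset Printing Implicit Defensive.

Import GRing.Theory.
Import GroupScope.

(* On a left brace, ring_scope operations are additive and group_scope ones
   are multiplicative. *)
HB.mixin Record Zmodule_Group_isLeftBrace B of GRing.Zmodule B & monoid.Group B := {
  brace_mulDr : forall a b c : B,
    (a * (b + c)%R)%g = ((a * b)%g - a + (a * c)%g)%R
}.

#[short(type="leftBraceType")]
HB.structure Definition LeftBrace :=
  {B of Zmodule_Group_isLeftBrace B & GRing.Zmodule B & monoid.Group B}.

(* Every finite zmodType also carries an additive finGroupType instance in
   finalg; for B : finLeftBraceType, however, the group inferred from B (in
   [set: B], \isog, {morphism _ >-> _}, ...) is the multiplicative one. *)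
#[short(type="finLeftBraceType")]
HB.structure Definition FinLeftBrace := {B of LeftBrace B & FinGroup B}.

Definition brace_iso (B C : leftBraceType) : Prop :=
  exists f : B -> C,
    [/\ bijective f,
        forall x y : B, f (x + y)%R = (f x + f y)%R
      & forall x y : B, f (x * y)%g = (f x * f y)%g].

Definition zmod_iso (U V : zmodType) : Prop :=
  exists f : {additive U -> V}, bijective f.

(* The group Aut(Z_p) is taken to be Z_p^*, a unit u acting as a |-> u * a. *)
Definition semidirect (p : nat) (F : finGroupType)
  (tau : {morphism [set: F] >-> {unit 'F_p}}) : Type := ('F_p * F)%type.

Section SemidirectGroup.
Variables (p : nat) (F : finGroupType).
Variable tau : {morphism [set: F] >-> {unit 'F_p}}.
Local Notation S := (semidirect tau).

HB.instance Definition _ := Finite.copy S ('F_p * F)%type.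

Definition semidirect_mul (x y : S) : S :=
  ((x.1 + val (tau x.2) * y.1)%R, (x.2 * y.2)%g).
Definition semidirect_one : S := (0%R, 1%g).
Definition semidirect_inv (x : S) : S :=
  ((- (val (tau x.2^-1%g) * x.1))%R, x.2^-1%g).

Lemma semidirect_mulA : associative semidirect_mul.
Proof.
move=> [a x] [b y] [c z]; rewrite /semidirect_mul /= mulgA morphM ?inE //=.
by rewrite mulrDr mulrA addrA.
Qed.

Lemma semidirect_mul1 : left_id semidirect_one semidirect_mul.
Proof. by move=> [a x]; rewrite /semidirect_mul /= morph1 mul1r add0r mul1g. Qed.

Lemma semidirect_mulV : left_inverse semidirect_one semidirect_inv semidirect_mul.
Proof.
by move=> [a x]; rewrite /semidirect_mul /= mulVg addNr.
Qed.

HB.instance Definition _ :=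
  Finite_isGroup.Build S semidirect_mulA semidirect_mul1 semidirect_mulV.

End SemidirectGroup.

Section SemidirectBrace.
Variables (p : nat) (B : finLeftBraceType).
Variable tau : {morphism [set: B] >-> {unit 'F_p}}.
Local Notation S := (semidirect tau).

HB.instance Definition _ := GRing.Zmodule.copy S ('F_p * B)%type.

Lemma semidirect_brace (a b c : S) :
  (a * (b + c)%R)%g = ((a * b)%g - a + (a * c)%g)%R.
Proof.
case: a b c => [a x] [b y] [c z]; congr pair => /=; last exact: brace_mulDr.
by rewrite mulrDr [(a + _ - a)%R]addrAC subrr add0r addrCA.
Qed.

HB.instance Definition _ :=
  Zmodule_Group_isLeftBrace.Build S semidirect_brace.

End SemidirectBrace.

Definition mulgroup_semidirect (p : nat) (F : finGroupType)
    (B : finLeftBraceType) : Prop :=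
  exists tau : {morphism [set: F] >-> {unit 'F_p}},
    [set: B] \isog [set: semidirect tau].

Definition is_direct_product (p : nat) (C : finLeftBraceType) : Prop :=
  exists B' : finLeftBraceType,
    #|B'| = 12 /\
    exists2 tau : {morphism [set: B'] >-> {unit 'F_p}},
      (forall b : B', tau b = 1%g) & brace_iso C (semidirect tau).

Definition has_kernel (p : nat) (P : forall gT : finGroupType, {group gT} -> Prop)
    (C : finLeftBraceType) : Prop :=
  exists B' : finLeftBraceType,
    #|B'| = 12 /\
    exists2 tau : {morphism [set: B'] >-> {unit 'F_p}},
      P B' ('ker tau)%G & brace_iso C (semidirect tau).

(* Main.v *)
Require Import Defs.
From HB Require Import structures.
From mathcomp Require Import all_boot all_order all_algebra all_fingroup all_solvable.
From mathcomp Require Import finfield.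
Set Implicit Arguments.
Unset Strict Implicit.
Unset Printing Implicit Defensive.
Import GRing.Theory.

(** A left brace [C] carries the lambda action [lam a b = a b - a] of its
multiplicative group on its additive group, and every additive torsion subgroup is
stable under it, hence is a multiplicative subgroup.  When the additive group is
['F_p * ('Z_6 * 'Z_2)], this gives multiplicative subgroups [P], [T], [V] of orders
[p], 3, 4 with [C = P + T + V].  When the multiplicative group is moreover a
semidirect product of ['F_p] by the dihedral group of order 12, that group has
normal subgroups of orders [p] and 3, which are [P] and [T], and its elements of
order dividing 4 square to [1], so [V] is elementary abelian.

A normal torsion subgroup acts trivially on torsion of coprime order
([lam_coprime_torsion]), a subgroup of prime order acts trivially on itself by
Fermat's little theorem ([line_scalar]), and [V] acts trivially on itself
([lam_gV_gV]).  The only remaining data are the characters by which [V] acts on [P]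
and [T]; as elements of [V] are involutions, both take the values [1] and [-1].  The
one on [T] is nontrivial, for otherwise [T] would be central.  Up to automorphisms
of [V], the pair consisting of the character on [T] and the one on [P] is then in
one of three positions: the second is trivial, or equal to the first, or neither
([klein_basis]).  This yields the three braces [model p 0], [model p 1] and
[model p 2] ([classification]).

The models are told apart by the set of elements acting trivially on the additive
[p]-torsion.  In a semidirect product of ['F_p] by a brace of order 12 this set is
['F_p] times the kernel of the defining morphism, so the order and the
commutativity of the kernel can be read from the isomorphism class
([has_kernel_invariant]): the kernel is everything in the first model, cyclic of
order 6 in the second and nonabelian of order 6 in the third. *)

(** * Additive and multiplicative bookkeeping *)

Lemma morph_add0 (U V : zmodType) (f : U -> V) :
  {morph f : x y / (x + y)%R} -> f 0%R = 0%R.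
Proof. by move=> fD; apply: (@addrI _ (f 0%R)); rewrite -fD !addr0. Qed.

Lemma morph_addMn (U V : zmodType) (f : U -> V) x n :
  {morph f : x y / (x + y)%R} -> f (x *+ n)%R = (f x *+ n)%R.
Proof.
move=> fD; elim: n => [|n IH]; first by rewrite !mulr0n morph_add0.
by rewrite !mulrS fD IH.
Qed.

Lemma morph_mul1 (G H : finGroupType) (f : G -> H) :
  {morph f : x y / (x * y)%g} -> f 1%g = 1%g.
Proof. by move=> fM; apply: (mulgI (f 1%g)); rewrite -fM !mulg1. Qed.

Lemma morph_mulX (G H : finGroupType) (f : G -> H) x n :
  {morph f : x y / (x * y)%g} -> f (x ^+ n)%g = (f x ^+ n)%g.
Proof.
move=> fM; elim: n => [|n IH]; first by rewrite !expg0 morph_mul1.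
by rewrite !expgS fM IH.
Qed.

Lemma isog_bij (G H : finGroupType) : [set: G] \isog [set: H] ->
  exists2 f : G -> H, bijective f & {morph f : x y / (x * y)%g}.
Proof.
case/isogP => f f_inj f_im; exists f; last by move=> x y; rewrite morphM ?inE.
have cGH : #|G| = #|H| by rewrite -!cardsT -f_im card_injm.
apply: inj_card_bij; last by rewrite cGH.
by move=> x y; apply: (injmP f_inj); rewrite inE.
Qed.

Section Torsion.
Variable V : zmodType.
Implicit Types a b : V.

Definition torsion n a := (a *+ n == 0)%R.

Lemma torsionD n a b : torsion n a -> torsion n b -> torsion n (a + b)%R.
Proof. by rewrite /torsion mulrnDl => /eqP -> /eqP ->; rewrite addr0. Qed.

Lemma torsionN n a : torsion n a -> torsion n (- a)%R.
Proof. by rewrite /torsion mulNrn oppr_eq0. Qed.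

Lemma torsion_coprime m n a : coprime m n -> torsion m a -> torsion n a -> a = 0%R.
Proof.
case: m => [|m] cop ta tb.
  by move: cop tb; rewrite /coprime gcd0n => /eqP -> /eqP.
have [u v def_u _] := egcdnP n (ltn0Sn m).
have : (a *+ (u * m.+1) = a *+ (v * n + gcdn m.+1 n))%R by rewrite def_u.
move: cop; rewrite /coprime mulrnDr => /eqP ->.
by rewrite (mulnC u) (mulnC v) !mulrnA (eqP ta) (eqP tb) !mul0rn add0r mulr1n.
Qed.

End Torsion.

Lemma torsion_Fp q (a : 'F_q) : prime q -> torsion q a.
Proof. by move=> q_pr; rewrite /torsion -mulr_natr pchar_Fp_0 ?mulr0. Qed.

Lemma coprime_small_prime p q : prime p -> 7 <= p -> prime q -> q < 7 -> coprime p q.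
Proof.
move=> p_pr p_ge7 q_pr q_lt7; rewrite prime_coprime // dvdn_prime2 //.
by apply/eqP => e; move: q_lt7; rewrite -e ltnNge p_ge7.
Qed.

Lemma coprime12 p : prime p -> 7 <= p -> coprime 12 p.
Proof.
move=> p_pr p_ge7; have -> : 12 = 2 ^ 2 * 3 by [].
by rewrite coprime_sym coprimeMr coprimeXr ?coprime_small_prime.
Qed.

(** Translation by [a] permutes [V], so the sum of all elements is unchanged when
[a] is added to each of them. *)
Lemma mulrn_card_eq0 (V : finZmodType) (a : V) : (a *+ #|V|)%R = 0%R.
Proof.
apply: (addrI (\sum_(x in V) x)%R); rewrite -sumr_const -big_split addr0 /=.
by rewrite -(reindex_inj (addIr a) (P := predT) (F := id)).
Qed.

(** * The lambda action of a left brace *)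

Section LeftBraceTheory.
Variable B : leftBraceType.
Implicit Types a b c x y : B.

Lemma brace_mulr0 a : (a * 0%R)%g = a.
Proof.
apply/eqP; rewrite -subr_eq0; apply/eqP.
have := brace_mulDr a 0%R 0%R; rewrite addr0 => /(congr1 (+%R^~ (- (a * 0%R)%g)%R)) /=.
by rewrite subrr -addrA subrr addr0 => <-.
Qed.

Lemma brace_zeroE : 0%R = 1%g :> B.
Proof. by rewrite -[LHS]mul1g brace_mulr0. Qed.

(** The standard lambda map of brace theory; [lamD] and [lamM] say that it is an
action of the multiplicative group by additive automorphisms. *)
Definition lam a b : B := ((a * b)%g - a)%R.

Lemma mul_lam a b : (a * b)%g = (a + lam a b)%R.
Proof. by rewrite addrC subrK. Qed.

Lemma lam0 a : lam a 0%R = 0%R.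
Proof. by rewrite /lam brace_mulr0 subrr. Qed.

Lemma lamD a b c : lam a (b + c)%R = (lam a b + lam a c)%R.
Proof. by rewrite /lam brace_mulDr addrA. Qed.

Lemma lamMn a b n : lam a (b *+ n)%R = (lam a b *+ n)%R.
Proof. by elim: n => [|n IH]; rewrite ?mulr0n ?lam0 // !mulrS lamD IH. Qed.

Lemma lam1 b : lam 1%g b = b.
Proof. by rewrite /lam mul1g -brace_zeroE subr0. Qed.

Lemma lamM a b c : lam (a * b)%g c = lam a (lam b c).
Proof.
apply: (@addrI _ (a * b)%g); rewrite -mul_lam -mulgA (mul_lam b c) brace_mulDr.
by rewrite addrAC -addrA.
Qed.

Lemma lam_inj a : injective (lam a).
Proof. by move=> b c /addIr /mulgI. Qed.

Lemma torsion_lam n a b : torsion n b -> torsion n (lam a b).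
Proof. by rewrite /torsion -lamMn => /eqP ->; rewrite lam0. Qed.

Lemma torsionM n a b : torsion n a -> torsion n b -> torsion n (a * b)%g.
Proof. by move=> ta tb; rewrite mul_lam torsionD ?torsion_lam. Qed.

(** With [c = b^-1 a b], the two expansions of [a b = b c] give
[lam a b - b = lam b c - a].  The left side is [n]-torsion; since [c] is
[m]-torsion by normality, the right side is [m]-torsion.  So both vanish. *)
Lemma lam_coprime_torsion m n a b : coprime m n ->
    (forall x y, torsion m x -> torsion m (x ^ y)%g) ->
  torsion m a -> torsion n b -> lam a b = b.
Proof.
move=> cop normm ta tb; apply/eqP; rewrite -subr_eq0; apply/eqP.
have tc := normm _ b ta.
apply: (torsion_coprime cop); last by rewrite torsionD ?torsion_lam ?torsionN.
suff -> : (lam a b - b)%R = (lam b (a ^ b)%g - a)%R.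
  by rewrite torsionD ?torsion_lam ?torsionN.
apply/eqP; rewrite subr_eq addrAC eq_sym subr_eq; apply/eqP.
by rewrite [RHS]addrC -mul_lam [LHS]addrC -mul_lam conjgE mulKVg.
Qed.

End LeftBraceTheory.

Lemma brace_iso_sym (B C : leftBraceType) : brace_iso B C -> brace_iso C B.
Proof.
case=> f [[g fK gK] fD fM]; exists g; split; first by exists f.
  by move=> x y; rewrite -[in LHS](gK x) -[in LHS](gK y) -fD fK.
by move=> x y; rewrite -[in LHS](gK x) -[in LHS](gK y) -fM fK.
Qed.

Lemma brace_iso_refl (B : leftBraceType) : brace_iso B B.
Proof. by exists id; split=> //; exists id. Qed.

(** * The lambda action on torsion of prime order *)

Section Scalars.
Variables (B : leftBraceType) (q : nat) (g : 'F_q -> B).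
Hypotheses (q_prime : prime q) (gD : {morph g : x y / (x + y)%R}).
Hypotheses (g_inj : injective g).
Hypotheses (gtors : forall c : B, torsion q c -> exists a, c = g a).

(** An additive endomorphism of a group of prime order [q] is multiplication by a
scalar, so the lambda action on the [q]-torsion is a character [k] with values in
['F_q].  It kills elements of order [q] because [k c ^+ q = k c] there, and it
takes involutions to square roots of [1]. *)
Lemma line_scalar : exists2 k : B -> 'F_q,
    (forall c a, lam c (g a) = g (k c * a)%R)
  & [/\ {morph k : c d / (c * d)%g >-> (c * d)%R},
        (forall c, (c ^+ q)%g = 1%g -> k c = 1%R)
      & (forall c, (c * c)%g = 1%g -> k c = 1%R \/ k c = (- 1)%R)].
Proof.
have g1_tors : torsion q (g 1%R).
  rewrite /torsion -(morph_addMn _ _ gD) (eqP (torsion_Fp _ q_prime)).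
  by rewrite (morph_add0 gD).
have exk c : exists x, lam c (g 1%R) == g x.
  by have [x ->] := gtors (torsion_lam c g1_tors); exists x.
pose k c := xchoose (exk c).
have kE c a : lam c (g a) = g (k c * a)%R.
  rewrite -(natr_Zp a) (morph_addMn _ _ gD) lamMn (eqP (xchooseP (exk c))).
  by rewrite -(morph_addMn _ _ gD) mulr_natr.
have k1 : k 1%g = 1%R.
  by apply: g_inj; have := kE 1%g 1%R; rewrite lam1 mulr1.
have kM : {morph k : c d / (c * d)%g >-> (c * d)%R}.
  move=> c d; apply: g_inj.
  by have := kE (c * d)%g 1%R; rewrite lamM !kE !mulr1.
have kX c n : k (c ^+ n)%g = (k c ^+ n)%R.
  by elim: n => [|n IH]; rewrite ?expg0 ?expr0 // expgS exprS kM IH.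
exists k => //; split=> // c.
  by move=> cq1; rewrite -(expf_card (k c)) card_Fp // -kX cq1.
move=> c2; have := kM c c; rewrite c2 k1 => /esym/eqP.
by rewrite -expr2 sqrf_eq1 => /orP[] /eqP; [left | right].
Qed.

End Scalars.

(** * The three models *)

(** Both group structures of ['F_2 * 'F_2] are addition, so this is the trivial
brace on the Klein four-group; the type is named so that the additive and the
multiplicative structure can be joined into a left brace on it. *)
Definition klein : Type := ('F_2 * 'F_2)%type.
HB.instance Definition _ := FinGroup.copy klein ('F_2 * 'F_2)%type.
HB.instance Definition _ := GRing.Zmodule.copy klein ('F_2 * 'F_2)%type.

Lemma klein_mulE (v w : klein) : (v * w)%g = (v + w)%R.
Proof. by []. Qed.

Lemma klein_brace (a b c : klein) :
  (a * (b + c)%R)%g = ((a * b)%g - a + (a * c)%g)%R.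
Proof. by rewrite !klein_mulE [(a + b - a)%R]addrAC subrr add0r addrCA. Qed.

HB.instance Definition _ := Zmodule_Group_isLeftBrace.Build klein klein_brace.

Definition sgn p (b : 'F_2) : {unit 'F_p} :=
  (FinRing.Unit (unitrN1 'F_p) ^+ b)%g.

Lemma val_sgn p b : val (sgn p b) = ((-1) ^+ b)%R.
Proof.
rewrite /sgn; elim: (b : nat) => [|n IH]; first by rewrite expg0 expr0.
by rewrite expgS exprS -IH.
Qed.

Lemma sgnD p a b : sgn p (a + b)%R = (sgn p a * sgn p b)%g.
Proof.
apply/val_inj; rewrite /= -!/(val _) !val_sgn.
by case: a b => [[|[|//]] ?] [[|[|//]] ?];
  rewrite /= ?expr0 ?expr1 ?mulr1 ?mul1r ?mulrNN ?mulr1.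
Qed.

(** Representatives of the linear forms [be] on the Klein group up to the
automorphisms fixing the first projection: either [be] vanishes, or it is that
projection, or it is neither of the two. *)
Definition weight (i : nat) (v : klein) : 'F_2 :=
  match i with 0 => 0%R | 1 => v.1 | _ => v.2 end.

Lemma weightD i v w : weight i (v + w)%R = (weight i v + weight i w)%R.
Proof. by case: i => [|[|i]] //=; rewrite addr0. Qed.

Definition weight_char p i (v : klein) : {unit 'F_p} := sgn p (weight i v).

Lemma weight_charM p i :
  {in [set: klein] &, {morph weight_char p i : v w / (v * w)%g}}.
Proof. by move=> v w _ _; rewrite /weight_char klein_mulE weightD sgnD. Qed.

Canonical weight_char_morphism p i := Morphism (@weight_charM p i).

(** The character chosen is nontrivial, which makes the multiplicative group
dihedral rather than abelian; all nontrivial choices are conjugate under the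
automorphisms of [klein]. *)
Definition brace12 : finLeftBraceType := semidirect [morphism of weight_char 3 1].

Definition model_char p i (h : brace12) : {unit 'F_p} := weight_char p i h.2.

Lemma model_charM p i :
  {in [set: brace12] &, {morph model_char p i : v w / (v * w)%g}}.
Proof. by move=> v w _ _; rewrite /model_char -weight_charM ?inE. Qed.

Canonical model_char_morphism p i := Morphism (@model_charM p i).

(** By the choice of [weight], [model p 0] is a direct product, the character of
[model p 1] is that of [brace12] and so has the kernel of order 6 centralising
['F_3], and the kernel of the character of [model p 2] inverts ['F_3]. *)
Definition model p i : finLeftBraceType := semidirect [morphism of model_char p i].

Lemma card_brace12 : #|brace12| = 12.
Proof. by rewrite !card_prod !card_Fp. Qed.

(** * The additive and multiplicative groups of the models *)

Lemma order_invol (gT : finGroupType) (x : gT) :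
  x != 1%g -> (x * x = 1)%g -> #[x]%g = 2.
Proof. by move=> nx x2; apply: (@nt_prime_order _ 2) => //; rewrite expgS expg1. Qed.

(** Two distinct involutions generate a dihedral group; the reflections [x] and [y]
are chosen so that [y * x] has order 6, hence generate everything. *)
Lemma isog_D12 : [set: brace12] \isog [set: 'D_12].
Proof.
pose x : brace12 := (0%R, (1%R, 0%R)); pose y : brace12 := (1%R, (1%R, 1%R)).
have x2 : #[x]%g = 2.
  by apply: order_invol => //; apply/eqP; vm_compute.
have y2 : #[y]%g = 2.
  by apply: order_invol => //; apply/eqP; vm_compute.
have := involutions_gen_dihedral x2 y2 isT.
suff -> : <<[set x; y]>>%g = [set: brace12] by rewrite cardsT card_brace12.
apply/eqP; rewrite eqEsubset subsetT /=; apply/subsetP => h _.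
have Gx : x \in <<[set x; y]>>%g by rewrite mem_gen // !inE eqxx.
have Gy : y \in <<[set x; y]>>%g by rewrite mem_gen // !inE eqxx orbT.
(* [r ^+ 4] generates the factor ['F_3], [r ^+ 3] is the central involution. *)
pose r := (y * x)%g.
suff -> : h = (r ^+ (4 * h.1) * x ^+ (h.2.1) * r ^+ (3 * h.2.2))%g.
  by rewrite !groupM ?groupX ?groupM.
by apply/eqP; case: h => [[[|[|[|//]]] ?] [[[|[|//]] ?] [[|[|//]] ?]]]; vm_compute.
Qed.

(** The weights 4 and 3 are the idempotents of ['Z_6] that are [1] modulo 3 and
modulo 2. *)
Definition crt_map (m : 'F_3 * klein) : 'Z_6 * 'Z_2 :=
  (inZp (4 * m.1 + 3 * m.2.1), inZp m.2.2).

Lemma crt_mapD : {morph crt_map : m n / (m + n)%R}.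
Proof.
move=> m n; apply/eqP; case: m n => [[[|[|[|//]]] ?] [[[|[|//]] ?] [[|[|//]] ?]]];
by case=> [[[|[|[|//]]] ?] [[[|[|//]] ?] [[|[|//]] ?]]]; vm_compute.
Qed.

Lemma crt_map_inj : injective crt_map.
Proof.
suff E m n : (crt_map m == crt_map n) ==> (m == n).
  by move=> m n /eqP/(implyP (E m n))/eqP.
case: m n => [[[|[|[|//]]] ?] [[[|[|//]] ?] [[|[|//]] ?]]];
by case=> [[[|[|[|//]]] ?] [[[|[|//]] ?] [[|[|//]] ?]]]; vm_compute.
Qed.

Lemma zmod_iso_sym (U V : zmodType) : zmod_iso U V ->
  exists2 g : V -> U, bijective g & {morph g : x y / (x + y)%R}.
Proof.
case=> f [g fK gK]; exists g; first by exists f.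
by move=> x y; rewrite -[in LHS](gK x) -[in LHS](gK y) -raddfD fK.
Qed.

Lemma zmod_iso_of (U V : zmodType) (f : U -> V) :
  bijective f -> {morph f : x y / (x + y)%R} -> zmod_iso U V.
Proof.
move=> f_bij fD.
pose fA := GRing.isNmodMorphism.Build U V f (conj (morph_add0 fD) fD).
pose F : {additive U -> V} := HB.pack f fA.
by exists F.
Qed.

Lemma crt_map_bij : bijective crt_map.
Proof. by apply: inj_card_bij crt_map_inj _; rewrite !card_prod !card_ord. Qed.

Lemma pair_crt_bij (p : nat) :
  bijective (fun m : 'F_p * ('F_3 * klein) => (m.1, crt_map m.2)).
Proof.
have [f cK fK] := crt_map_bij.
by exists (fun m => (m.1, f m.2)) => [[a m]|[a m]] /=; rewrite ?cK ?fK.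
Qed.

Lemma model_zmod_iso p i : zmod_iso (model p i) ('F_p * ('Z_6 * 'Z_2))%type.
Proof.
apply: (zmod_iso_of (pair_crt_bij p)) => -[a m] [b n].
by rewrite /= [crt_map _]crt_mapD.
Qed.

Lemma semidirect_transport p (F G : finGroupType)
    (tau : {morphism [set: F] >-> {unit 'F_p}}) :
    [set: F] \isog [set: G] ->
  exists sigma : {morphism [set: G] >-> {unit 'F_p}},
    [set: semidirect tau] \isog [set: semidirect sigma].
Proof.
rewrite isog_sym => /isogP[f f_inj f_im].
have sM : {in [set: G] &, {morph (fun g => tau (f g)) : x y / (x * y)%g}}.
  by move=> x y _ _; rewrite !morphM ?inE.
exists (Morphism sM).
pose h (x : semidirect (Morphism sM)) : semidirect tau := (x.1, f x.2).
have hM : {in setT &, {morph h : x y / (x * y)%g}}.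
  by move=> [a x] [b y] _ _; rewrite /h /= morphM ?inE.
rewrite isog_sym; apply/isogP; exists (Morphism hM).
  apply/injmP => -[a x] [b y] _ _ [-> /(injmP f_inj) exy].
  by rewrite exy ?inE.
apply/setP => -[a y]; rewrite inE; apply/morphimP.
have : y \in (f @* setT)%g by rewrite f_im inE.
by case/morphimP => x _ _ ->; exists (a, x); rewrite ?inE.
Qed.

Lemma model_mulgroup p i : mulgroup_semidirect p 'D_12 (model p i).
Proof. exact: semidirect_transport isog_D12. Qed.

(** * Kernels of the model characters *)

Lemma Fp_N1_neq1 p : prime p -> 2 < p -> (-1 == 1 :> 'F_p)%R = false.
Proof.
move=> p_pr p_gt2; rewrite eq_sym -subr_eq0 opprK; apply/negP => p2.
have := pcharf_eq (pchar_Fp p_pr) 2; rewrite [LHS]inE /= p2 => /esym.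
by rewrite inE => /eqP e2; rewrite -e2 in p_gt2.
Qed.

Lemma sgn_eq1 p b : prime p -> 2 < p -> (sgn p b == 1%g) = (b == 0%R).
Proof.
move=> p_pr p_gt2; rewrite -val_eqE /= -/(val _) val_sgn.
by case: b => [[|[|//]] ?]; rewrite ?expr0 ?expr1 ?Fp_N1_neq1 ?eqxx.
Qed.

Section Kernels.
Variable p : nat.
Hypotheses (p_prime : prime p) (p_gt2 : 2 < p).

Lemma mem_ker_model_char i (h : brace12) :
  (h \in 'ker (model_char_morphism p i))%g = (weight i h.2 == 0%R).
Proof. by rewrite !inE /= /model_char /weight_char sgn_eq1. Qed.

Lemma card_ker_model_char1 : #|('ker (model_char_morphism p 1))%g| = 6.
Proof.
pose f (z : 'F_3 * 'F_2) : brace12 := (z.1, (0%R, z.2)).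
have f_inj : injective f by move=> [t b] [t' b'] [-> ->].
suff -> : ('ker (model_char_morphism p 1))%g = f @: setT.
  by rewrite card_imset // cardsT card_prod !card_Fp.
apply/setP => h; rewrite mem_ker_model_char; apply/eqP/imsetP => /= [|[z _ ->] //].
by case: h => t [a b] /= ->; exists (t, b); rewrite ?inE.
Qed.

Lemma card_ker_model_char2 : #|('ker (model_char_morphism p 2))%g| = 6.
Proof.
pose f (z : 'F_3 * 'F_2) : brace12 := (z.1, (z.2, 0%R)).
have f_inj : injective f by move=> [t b] [t' b'] [-> ->].
suff -> : ('ker (model_char_morphism p 2))%g = f @: setT.
  by rewrite card_imset // cardsT card_prod !card_Fp.
apply/setP => h; rewrite mem_ker_model_char; apply/eqP/imsetP => /= [|[z _ ->] //].
by case: h => t [a b] /= ->; exists (t, a); rewrite ?inE.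
Qed.

(** The generator [r] has order 6, its components being elements of orders 3
and 2 that commute. *)
Lemma cyclic_ker_model_char1 : cyclic ('ker (model_char_morphism p 1))%g.
Proof.
pose r : brace12 := (1%R, (0%R, 1%R)).
apply/cyclicP; exists r; apply/eqP; rewrite eq_sym eqEsubset cycle_subG.
rewrite mem_ker_model_char eqxx /=; apply/subsetP => h; rewrite mem_ker_model_char.
suff /implyP E : (weight 1 h.2 == 0%R) ==> (h == r ^+ (4 * h.1 + 3 * h.2.2))%g.
  by move=> /E /eqP ->; rewrite mem_cycle.
by case: h => [[[|[|[|//]]] ?] [[[|[|//]] ?] [[|[|//]] ?]]]; vm_compute.
Qed.

(** The kernel contains the two distinct involutions [x] and [y], whose product
generates ['F_3]. *)
Lemma isog_ker_model_char2 : ('ker (model_char_morphism p 2) \isog 'D_6)%g.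
Proof.
pose x : brace12 := (0%R, (1%R, 0%R)); pose y : brace12 := (1%R, (1%R, 0%R)).
have x2 : #[x]%g = 2 by apply: order_invol => //; apply/eqP; vm_compute.
have y2 : #[y]%g = 2 by apply: order_invol => //; apply/eqP; vm_compute.
have := involutions_gen_dihedral x2 y2 isT.
suff -> : <<[set x; y]>>%g = ('ker (model_char_morphism p 2))%g.
  by rewrite card_ker_model_char2.
apply/eqP; rewrite eqEsubset gen_subG; apply/andP; split; apply/subsetP => h.
  by case/set2P => ->; rewrite mem_ker_model_char.
have Gx : x \in <<[set x; y]>>%g by rewrite mem_gen // !inE eqxx.
have Gy : y \in <<[set x; y]>>%g by rewrite mem_gen // !inE eqxx orbT.
rewrite mem_ker_model_char.
suff /implyP E : (weight 2 h.2 == 0%R) ==> (h == (y * x) ^+ h.1 * x ^+ h.2.1)%g.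
  by move=> /E /eqP ->; rewrite !groupM ?groupX ?groupM.
by case: h => [[[|[|[|//]]] ?] [[[|[|//]] ?] [[|[|//]] ?]]]; vm_compute.
Qed.

End Kernels.

(** * Invariants detecting the kernel *)

Section Invariants.
Variable p : nat.
Hypotheses (p_prime : prime p) (p_ge7 : 7 <= p).

(** An isomorphism-invariant name for the kernel: in a semidirect product of ['F_p]
by a brace of order prime to [p], the additive [p]-torsion is the factor ['F_p], on
which [lam] acts through the defining character. *)
Definition fixes_torsion (C : leftBraceType) (c : C) : Prop :=
  forall z : C, torsion p z -> lam c z = z.

Lemma fixes_torsionP (B : finLeftBraceType)
    (tau : {morphism [set: B] >-> {unit 'F_p}}) (c : semidirect tau) :
  #|B| = 12 -> fixes_torsion c <-> c.2 \in ('ker tau)%g.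
Proof.
move=> cB.
have mulrnE (z : semidirect tau) n : (z *+ n)%R = ((z.1 *+ n)%R, (z.2 *+ n)%R).
  by elim: n => [|n IH] //; rewrite !mulrS IH.
have lamE (z : semidirect tau) : z.2 = 0%R -> lam c z = ((val (tau c.2) * z.1)%R, 0%R).
  case: z c => a b [a0 b0] /= ->; congr pair => /=; last by rewrite brace_mulr0 subrr.
  by rewrite addrC addKr.
rewrite !inE /=; split => [ct|/eqP t1 [a b]].
  have /ct : torsion p ((1%R, 0%R) : semidirect tau).
    by rewrite /torsion mulrnE /= pchar_Fp_0 ?mul0rn.
  by rewrite lamE //= mulr1 => -[e]; apply/eqP/val_inj.
rewrite /torsion mulrnE => /eqP[_ /= /eqP bp].
have b0 : b = 0%R.
  apply: torsion_coprime (coprime12 p_prime p_ge7) _ bp.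
  by rewrite /torsion -cB (@mulrn_card_eq0 B).
by rewrite lamE //= t1 b0 mul1r.
Qed.

Lemma fixes_torsion_iso (C D : leftBraceType) (f : C -> D) c :
    bijective f -> {morph f : x y / (x + y)%R} -> {morph f : x y / (x * y)%g} ->
  fixes_torsion c -> fixes_torsion (f c).
Proof.
case=> g fK gK fD fM cK z tz.
have tgz : torsion p (g z).
  by rewrite /torsion -(inj_eq (can_inj fK)) (morph_addMn _ _ fD) gK (morph_add0 fD).
by apply: (@addrI _ (f c)); rewrite -mul_lam -[z in LHS]gK -fM mul_lam cK // fD gK.
Qed.

Definition all_fix_torsion (C : leftBraceType) : Prop :=
  forall c : C, fixes_torsion c.

Definition fixators_commute (C : leftBraceType) : Prop :=
  forall c d : C, fixes_torsion c -> fixes_torsion d -> commute c d.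

Lemma all_fix_torsion_iso (C D : leftBraceType) :
  brace_iso C D -> all_fix_torsion C -> all_fix_torsion D.
Proof.
case=> f [f_bij fD fM] aC d; have [g _ gK] := f_bij.
by rewrite -(gK d); apply: fixes_torsion_iso.
Qed.

Lemma fixators_commute_iso (C D : leftBraceType) :
  brace_iso C D -> fixators_commute C -> fixators_commute D.
Proof.
move=> /brace_iso_sym [f [f_bij fD fM]] aC c d kc kd; apply: (bij_inj f_bij).
by rewrite !fM; apply: aC; apply: fixes_torsion_iso.
Qed.

Section SemidirectInvariants.
Variables (B : finLeftBraceType) (tau : {morphism [set: B] >-> {unit 'F_p}}).
Hypothesis cB : #|B| = 12.

Lemma all_fix_torsionP :
  all_fix_torsion (semidirect tau) <-> #|('ker tau)%g| = 12.
Proof.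
split=> [a|kT [a b]].
  rewrite -cB -cardsT; suff -> : ('ker tau)%g = [set: B] by [].
  apply/setP => b; rewrite [RHS]inE.
  exact/(fixes_torsionP ((0%R, b) : semidirect tau) cB).
apply/fixes_torsionP => //=.
suff -> : ('ker tau)%g = [set: B] by rewrite inE.
by apply/eqP; rewrite eqEcard subsetT cardsT cB kT.
Qed.

Lemma fixators_commuteP :
  fixators_commute (semidirect tau) <-> abelian ('ker tau)%g.
Proof.
split=> [a|/centsP ab [a b] [c d]].
  apply/centsP => b kb c kc.
  have kE x : x \in ('ker tau)%g -> fixes_torsion ((0%R, x) : semidirect tau).
    by move=> kx; apply/fixes_torsionP.
  by have [_] := a _ _ (kE b kb) (kE c kc).
move=> /fixes_torsionP /= /(_ cB) kb /fixes_torsionP /= /(_ cB) kd.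
congr pair => /=; last exact: ab.
by rewrite (mker kb) (mker kd) !mul1r addrC.
Qed.

End SemidirectInvariants.

End Invariants.

Lemma D6_nonabelian : ~~ abelian [set: 'D_6]%g.
Proof.
(* The kernel of [model_char p 2] is the same subgroup for every odd prime. *)
rewrite -(isog_abelian (@isog_ker_model_char2 3 isT isT)).
pose x : brace12 := (0%R, (1%R, 0%R)); pose y : brace12 := (1%R, (0%R, 0%R)).
apply/centsP => /(_ x _ y _); rewrite !mem_ker_model_char // => /(_ isT isT) /eqP.
by vm_compute.
Qed.

Lemma D6_kernel_invariant (gT : finGroupType) (K : {group gT}) :
  (K \isog [set: 'D_6])%g -> #|K| = 6 /\ abelian K = false.
Proof.
move=> isoK; rewrite (card_isog isoK) (@card_dihedral 3) // (isog_abelian isoK).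
by rewrite (negPf D6_nonabelian).
Qed.

Section KernelTypes.
Variable p : nat.
Hypotheses (p_prime : prime p) (p_ge7 : 7 <= p).

Lemma direct_product_invariant (C : finLeftBraceType) :
  is_direct_product p C -> all_fix_torsion p C.
Proof.
case=> B [cB [tau tau1 /brace_iso_sym isoC]].
apply: all_fix_torsion_iso isoC _; apply/all_fix_torsionP => //.
by rewrite -cB -cardsT; congr #|pred_of_set _|; apply/setP => b; rewrite !inE tau1 eqxx.
Qed.

(** Whenever the order and commutativity of the kernel are prescribed, the two
invariants of the brace are known, whichever decomposition exhibits the kernel. *)
Lemma has_kernel_invariant (P : forall gT : finGroupType, {group gT} -> Prop) n b
    (C : finLeftBraceType) :
    (forall (gT : finGroupType) (K : {group gT}),
       P gT K -> #|K| = n /\ abelian K = b) ->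
    has_kernel p P C ->
  (all_fix_torsion p C <-> n = 12) /\ (fixators_commute p C <-> b).
Proof.
move=> PK [B [cB [tau /PK[<- <-] isoC]]]; have isoC' := brace_iso_sym isoC.
split; split.
- by move=> /(all_fix_torsion_iso isoC)/all_fix_torsionP; apply.
- by move=> k12; apply: all_fix_torsion_iso isoC' _; apply/all_fix_torsionP.
- by move=> /(fixators_commute_iso isoC)/fixators_commuteP; apply.
by move=> ab; apply: fixators_commute_iso isoC' _; apply/fixators_commuteP.
Qed.

Lemma model_direct_product : is_direct_product p (model p 0).
Proof.
exists brace12; split; first exact: card_brace12.
exists (model_char_morphism p 0); last exact: brace_iso_refl.
by move=> b; apply/eqP; rewrite sgn_eq1 // (leq_trans _ p_ge7).
Qed.

Lemma model_has_cyclic_kernel :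
  has_kernel p (fun gT K => cyclic K /\ #|K| = 6) (model p 1).
Proof.
have p_gt2 : 2 < p by apply: leq_trans p_ge7.
exists brace12; split; first exact: card_brace12.
exists (model_char_morphism p 1); last exact: brace_iso_refl.
by rewrite cyclic_ker_model_char1 ?card_ker_model_char1.
Qed.

Lemma model_has_D6_kernel : has_kernel p (fun gT K => K \isog 'D_6)%g (model p 2).
Proof.
have p_gt2 : 2 < p by apply: leq_trans p_ge7.
exists brace12; split; first exact: card_brace12.
exists (model_char_morphism p 2); last exact: brace_iso_refl.
exact: isog_ker_model_char2.
Qed.

End KernelTypes.

(** * Elements of small order in the semidirect products *)

Section SemidirectFacts.
Variable p : nat.
Hypotheses (p_prime : prime p) (p_ge7 : 7 <= p).
Variable sigma : {morphism [set: brace12] >-> {unit 'F_p}}.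
Local Notation S := (semidirect sigma).
Implicit Type s : S.

(** The rotations of order 3 are products [x * r * x * r'] with [x] an involution
and [r * r' = 1], which any morphism to an abelian group sends to [1]. *)
Lemma sigma_rot (t : 'F_3) : sigma ((t, 0%R) : brace12) = 1%g.
Proof.
pose x : brace12 := (0%R, (1%R, 0%R)).
pose r : brace12 := (t, 0%R); pose r' : brace12 := ((t + t)%R, 0%R).
have -> : ((t, 0%R) : brace12) = (x * r * x * r')%g.
  by apply/eqP; rewrite /r /r'; case: t @r @r' => [[|[|[|//]]] ?]; vm_compute.
have x2 : (x * x)%g = 1%g by apply/eqP; vm_compute.
have rr : (r * r')%g = 1%g.
  by apply/eqP; rewrite /r /r'; case: t @r @r' => [[|[|[|//]]] ?]; vm_compute.
have uC (u v : {unit 'F_p}) : (u * v = v * u)%g by apply/val_inj/mulrC.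
rewrite !morphM ?inE // -!mulgA (uC (sigma x) (sigma r')) (mulgA (sigma r)).
by rewrite -(morphM _ (x := r)) ?inE // rr morph1 mul1g -morphM ?inE // x2 morph1.
Qed.

Lemma semidirect_expg2 s n : (s ^+ n)%g.2 = (s.2 ^+ n)%g.
Proof. by elim: n => [|n IH] //; rewrite !expgS /= IH. Qed.

Lemma semidirect_order_p s : (s ^+ p = 1)%g -> s.2 = 1%g.
Proof.
move=> /(congr1 snd); rewrite semidirect_expg2 /= => s2p.
have s212 : (s.2 ^+ 12 = 1)%g by rewrite -card_brace12 -cardsT expg_cardG ?inE.
have : #[s.2]%g %| gcdn 12 p by rewrite dvdn_gcd !order_dvdn s2p s212 eqxx.
by rewrite (eqP (coprime12 p_prime p_ge7)) dvdn1 order_eq1 => /eqP.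
Qed.

(** The Sylow 2-subgroups are elementary abelian: the dihedral group has no element
of order 4, and the remaining square lies in ['F_p], of odd order. *)
Lemma semidirect_exponent4 s : (s ^+ 4 = 1)%g -> (s * s = 1)%g.
Proof.
move=> s4; have : (s.2 ^+ 4 = 1)%g by rewrite -semidirect_expg2 s4.
case: s s4 => a h /= s4 h4.
have h2 : (h * h = 1)%g.
  have /implyP E : (h ^+ 4 == 1)%g ==> (h * h == 1)%g.
    by case: h {s4 h4} => [[[|[|[|//]]] ?] [[[|[|//]] ?] [[|[|//]] ?]]]; vm_compute.
  by apply/eqP/E/eqP.
pose b := (a + val (sigma h) * a)%R.
have s2 : (((a, h) : S) * (a, h))%g = (b, 1%g).
  by rewrite -h2.
have : (((b, 1%g) : S) * (b, 1%g))%g = 1%g.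
  by rewrite -s2 -{}s4 !expgS expg0 mulg1 !mulgA.
move=> /(congr1 fst) /=; rewrite morph1 mul1r => b2.
rewrite s2; congr pair.
apply: (@torsion_coprime _ p 2 _ _ (torsion_Fp _ p_prime)).
  by rewrite coprime_small_prime.
by rewrite /torsion mulr2n b2.
Qed.

Lemma semidirect_order3 s : (s ^+ 3 = 1)%g -> s.1 = 0%R /\ s.2.2 = 0%R.
Proof.
move=> s3; have : (s.2 ^+ 3 = 1)%g by rewrite -semidirect_expg2 s3.
case: s s3 => a [t v] /= s3 h3.
have v0 : v = 0%R.
  suff /implyP E : (((t, v) : brace12) ^+ 3 == 1)%g ==> (v == 0%R).
    by apply/eqP/E/eqP.
  by case: t v {s3 h3} => [[|[|[|//]]] ?] [[[|[|//]] ?] [[|[|//]] ?]]; vm_compute.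
split=> //; move: s3; rewrite v0 => /(congr1 fst).
rewrite !expgS expg0 mulg1 /= sigma_rot !mul1r => a3.
apply: (@torsion_coprime _ p 3 _ _ (torsion_Fp _ p_prime)).
  by rewrite coprime_small_prime.
by rewrite /torsion !mulrS mulr0n addr0 a3.
Qed.

Lemma semidirect_rot_noncentral :
  exists s z : S, (z ^+ 3 = 1 /\ s * z <> z * s)%g.
Proof.
exists (0%R, (0%R, (1%R, 0%R))), (0%R, (1%R, 0%R)); split.
  rewrite !expgS expg0 mulg1; congr pair; last by apply/eqP; vm_compute.
  by rewrite /= !(mulr0, addr0).
by move=> /(congr1 snd) /= /eqP; vm_compute.
Qed.

End SemidirectFacts.

(** * Torsion as a multiplicative subgroup *)

Section TorsionSubgroups.
Variable C : finLeftBraceType.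

Lemma torsion_group_set n : group_set [set c : C | torsion n c].
Proof.
apply/group_setP; split=> [|x y]; first by rewrite inE -brace_zeroE /torsion mul0rn.
by rewrite !inE => tx ty; rewrite torsionM.
Qed.

(** Lagrange's theorem in the multiplicative subgroup formed by the additive
[n]-torsion. *)
Lemma torsion_expg n (c : C) :
  torsion n c -> (c ^+ #|[set c : C | torsion n c]| = 1)%g.
Proof.
by move=> tc; rewrite (@expg_cardG _ (Group (torsion_group_set n))) // inE.
Qed.

(** Counting: the [n]-torsion has [n] elements, all satisfying [c ^+ n = 1], and
in the isomorphic group [G] at most [n] elements satisfy that equation.  As the
equation is invariant under conjugation, so is the torsion. *)
Lemma torsion_of_expg n (G : finGroupType) (f : C -> G) (T : finType) (u : G -> T) :
    injective f -> {morph f : x y / (x * y)%g} ->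
    {in [pred s : G | s ^+ n == 1]%g &, injective u} ->
    #|T| <= n -> #|[set c : C | torsion n c]| = n ->
  forall c : C, (c ^+ n = 1)%g -> torsion n c.
Proof.
move=> f_inj fM u_inj cT ct c cn.
pose A := [set c : C | (c ^+ n == 1)%g].
suff -> : torsion n c = (c \in A) by rewrite inE cn.
suff <- : [set c : C | torsion n c] = A by rewrite inE.
apply/eqP; rewrite eqEcard; apply/andP; split.
  by apply/subsetP => x; rewrite !inE => /torsion_expg; rewrite ct => ->.
rewrite ct -(@card_in_imset _ _ (u \o f)); first exact: leq_trans (max_card _) cT.
move=> x y; rewrite !inE => /eqP xn /eqP yn /= /u_inj e; apply/f_inj/e.
  by rewrite inE -(morph_mulX _ _ fM) xn (morph_mul1 fM).
by rewrite inE -(morph_mulX _ _ fM) yn (morph_mul1 fM).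
Qed.

End TorsionSubgroups.

(** * Linear forms on the Klein group *)

Lemma sign_form q (k : klein -> 'F_q) : prime q -> 2 < q ->
    {morph k : v w / (v + w)%R >-> (v * w)%R} ->
    (forall v, k v = 1%R \/ k v = (- 1)%R) ->
  exists2 al : klein -> 'F_2, {morph al : v w / (v + w)%R}
    & forall v, k v = ((-1) ^+ al v)%R.
Proof.
move=> q_pr q_gt2 kD k1.
have N1 := Fp_N1_neq1 q_pr q_gt2.
exists (fun v => if k v == 1%R then 0%R else 1%R) => [v w|v].
  by rewrite kD; case: (k1 v) (k1 w) => -> [] ->;
    rewrite ?mulrNN ?mul1r ?mulr1 ?eqxx ?N1 //; apply/eqP; vm_compute.
by case: (k1 v) => ->; rewrite ?eqxx ?N1.
Qed.

(** In the basis [e1], [e2] chosen below, [al] is the first coordinate.  The values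
of [be] on the basis then determine [be]; if both are [1], replacing [e1] by
[e1 + e2] makes the first one [0], and the three cases left are the three
weights. *)
Lemma klein_basis (al be : klein -> 'F_2) v0 :
    {morph al : v w / (v + w)%R} -> {morph be : v w / (v + w)%R} -> al v0 != 0%R ->
  exists2 e : klein -> klein, injective e /\ {morph e : v w / (v + w)%R}
    & exists i : 'I_3, forall v, al (e v) = weight 1 v /\ be (e v) = weight i v.
Proof.
move=> alD beD al_v0.
have F2P (b : 'F_2) : b = 0%R \/ b = 1%R.
  by case: b => [[|[|//]] ?]; [left | right]; apply/val_inj.
have lin (f : klein -> 'F_2) (e1 e2 v : klein) : {morph f : v w / (v + w)%R} ->
    f (e1 *+ v.1 + e2 *+ v.2)%R = (f e1 *+ v.1 + f e2 *+ v.2)%R.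
  move=> fD; have f0 := morph_add0 fD; rewrite fD; congr (_ + _)%R.
    by case: (F2P v.1) => ->; rewrite ?mulr0n ?mulr1n.
  by case: (F2P v.2) => ->; rewrite ?mulr0n ?mulr1n.
have [e1 [e2 [al1 al2 nz2]]] : exists e1 e2, [/\ al e1 = 1%R, al e2 = 0%R & e2 != 0%R].
  pose x : klein := (1%R, 0%R); pose y : klein := (0%R, 1%R).
  have std (v : klein) : v = (x *+ v.1 + y *+ v.2)%R.
    by apply/eqP; case: v => [[[|[|//]] ?] [[|[|//]] ?]]; vm_compute.
  case: (F2P (al x)) (F2P (al y)) => ax [] ay.
  - by move: al_v0; rewrite (std v0) lin // ax ay !mul0rn addr0 eqxx.
  - by exists y, x.
  - by exists x, y.
  - by exists x, (x + y)%R; rewrite alD ax ay; split=> //; apply/eqP; vm_compute.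
wlog {al_v0} : e1 al1 / be e1 = 0%R \/ be e2 = 0%R.
  move=> IH; case: (F2P (be e1)) => b1; first by apply: (IH e1) => //; left.
  case: (F2P (be e2)) => b2; first by apply: (IH e1) => //; right.
  apply: (IH (e1 + e2)%R); first by rewrite alD al1 al2 addr0.
  by left; rewrite beD b1 b2; apply/eqP; vm_compute.
have nat1 (b : 'F_2) : (1 *+ b)%R = b by rewrite natr_Zp.
have bd0 (b : 'F_2) : (0 *+ b)%R = 0%R :> 'F_2 by rewrite mul0rn.
have al_e (v : klein) : al (e1 *+ v.1 + e2 *+ v.2)%R = v.1.
  by rewrite lin // al1 al2 nat1 bd0 addr0.
move=> be12; exists (fun v : klein => e1 *+ v.1 + e2 *+ v.2)%R; first split.
- move=> [a b] [c d] /= e; have eac : a = c.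
    by have := al_e (a, b); rewrite /= e => <-; apply: (al_e (c, d)).
  move: e; rewrite eac => /addrI /= e; congr pair.
  case: (F2P b) (F2P d) e => -> [] -> //; rewrite mulr0n mulr1n => /eqP.
    by rewrite eq_sym (negPf nz2).
  by rewrite (negPf nz2).
- have MnD (x : klein) (a b : 'F_2) : (x *+ (a + b)%R)%R = (x *+ a + x *+ b)%R.
    have x2 : (x + x)%R = 0%R.
      by apply/eqP; case: x => [[[|[|//]] ?] [[|[|//]] ?]]; vm_compute.
    by case: (F2P a) (F2P b) => -> [] ->;
      rewrite ?addr0 ?add0r ?mulr0n ?mulr1n ?addr0 ?add0r ?x2.
  by move=> v w /=; rewrite !MnD addrACA.
have [i be_i] : exists i : 'I_3, forall v, weight i v = (be e1 *+ v.1 + be e2 *+ v.2)%R.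
  have [b1|b1] := F2P (be e1); last first.
    have b2 : be e2 = 0%R by case: be12 => //; rewrite b1.
    by exists 1%R => v; rewrite b1 b2 nat1 bd0 addr0.
  have [b2|b2] := F2P (be e2).
    by exists 0%R => v; rewrite b1 b2 !bd0 addr0.
  by exists ord_max => v; rewrite b1 b2 nat1 bd0 add0r.
by exists i => v; rewrite al_e be_i lin.
Qed.

Lemma klein_fourth (u v w : klein) :
  v != w -> w != 0%R -> v != 0%R -> u != 0%R -> u != v -> u != (v + w)%R -> u = w.
Proof.
suff /implyP E : [&& v != w, w != 0%R, v != 0%R, u != 0%R, u != v & u != (v + w)%R]
    ==> (u == w).
  by move=> h1 h2 h3 h4 h5 h6; apply/eqP/E; rewrite h1 h2 h3 h4 h5 h6.
case: u v w => [[[|[|//]] ?] [[|[|//]] ?]] [[[|[|//]] ?] [[|[|//]] ?]];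
  by case=> [[[|[|//]] ?] [[|[|//]] ?]]; vm_compute.
Qed.

(** * Classification *)

Section Classification.
Variables (p : nat) (C : finLeftBraceType).
Hypotheses (p_prime : prime p) (p_ge7 : 7 <= p).
Variable g : 'F_p * ('F_3 * klein) -> C.
Hypotheses (g_bij : bijective g) (gD : {morph g : x y / (x + y)%R}).
Variable sigma : {morphism [set: brace12] >-> {unit 'F_p}}.
Variable f : C -> semidirect sigma.
Hypotheses (f_bij : bijective f) (fM : {morph f : x y / (x * y)%g}).

(** The components of [C] for the additive decomposition [g]: the torsion of
orders [p], 3 and 2. *)
Definition gP (a : 'F_p) : C := g (a, (0%R, 0%R)).
Definition gT (t : 'F_3) : C := g (0%R, (t, 0%R)).
Definition gV (v : klein) : C := g (0%R, (0%R, v)).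

Let g_inj : injective g := bij_inj g_bij.
Let f_inj : injective f := bij_inj f_bij.

Lemma gE m : g m = (gP m.1 + gT m.2.1 + gV m.2.2)%R.
Proof.
by case: m => a [t v]; rewrite -!gD; congr (g (_, (_, _))); rewrite /= ?addr0 ?add0r.
Qed.

Lemma gPD : {morph gP : a b / (a + b)%R}.
Proof. by move=> a b; rewrite -gD; congr (g (_, (_, _))); rewrite /= ?addr0. Qed.

Lemma gTD : {morph gT : a b / (a + b)%R}.
Proof. by move=> a b; rewrite -gD; congr (g (_, (_, _))); rewrite /= ?addr0. Qed.

Lemma gVD : {morph gV : a b / (a + b)%R}.
Proof. by move=> a b; rewrite -gD; congr (g (_, (_, _))); rewrite /= ?addr0. Qed.

Lemma gP_inj : injective gP.
Proof. by move=> a b /g_inj []. Qed.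

Lemma gT_inj : injective gT.
Proof. by move=> a b /g_inj []. Qed.

Lemma gV_inj : injective gV.
Proof. by move=> a b /g_inj []. Qed.

Lemma torsion_g n (m : 'F_p * ('F_3 * klein)) :
  torsion n (g m) = [&& torsion n m.1, torsion n m.2.1 & torsion n m.2.2].
Proof.
rewrite /torsion -(morph_addMn _ _ gD) -(morph_add0 gD) (inj_eq g_inj).
have -> : (m *+ n)%R = ((m.1 *+ n)%R, ((m.2.1 *+ n)%R, (m.2.2 *+ n)%R)).
  by elim: n => [|n IH] //; rewrite !mulrS IH.
by [].
Qed.

Lemma torsion_klein (v : klein) : torsion 2 v.
Proof. by case: v => [[[|[|//]] ?] [[|[|//]] ?]]; vm_compute. Qed.

Let tF q r (a : 'F_q) : prime q -> coprime q r -> torsion r a -> a = 0%R.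
Proof. by move=> q_pr /torsion_coprime E /(E _ _ (torsion_Fp a q_pr)). Qed.
Let tV r (v : klein) : coprime 2 r -> torsion r v -> v = 0%R.
Proof. by move=> /torsion_coprime E /(E _ _ (torsion_klein v)). Qed.

Lemma torsion_pP (c : C) : torsion p c -> exists a, c = gP a.
Proof.
have [g' g'K gK] := g_bij; rewrite -(gK c); case: (g' c) => a [t v].
rewrite torsion_g /= => /and3P[_ tt tv]; exists a.
by rewrite (tF _ _ tt) ?(tV _ tv) // coprime_sym coprime_small_prime.
Qed.

Lemma torsion_3P (c : C) : torsion 3 c -> exists t, c = gT t.
Proof.
have [g' g'K gK] := g_bij; rewrite -(gK c); case: (g' c) => a [t v].
rewrite torsion_g /= => /and3P[ta _ tv]; exists t.
by rewrite (tF _ _ ta) ?(tV _ tv) // coprime_small_prime.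
Qed.

Lemma torsion_2P (c : C) : torsion 2 c -> exists v, c = gV v.
Proof.
have [g' g'K gK] := g_bij; rewrite -(gK c); case: (g' c) => a [t v].
rewrite torsion_g /= => /and3P[ta tt _]; exists v.
by rewrite (tF _ _ ta) ?(tF _ _ tt) // coprime_small_prime.
Qed.

Lemma torsion_gP a : torsion p (gP a).
Proof. by rewrite torsion_g torsion_Fp // /torsion !mul0rn eqxx. Qed.

Lemma torsion_gT t : torsion 3 (gT t).
Proof. by rewrite torsion_g torsion_Fp // /torsion !mul0rn eqxx. Qed.

Lemma torsion_gV v : torsion 2 (gV v).
Proof. by rewrite torsion_g torsion_klein /torsion !mul0rn eqxx. Qed.

Lemma card_torsion (T : finType) (h : T -> C) n : injective h ->
    (forall c : C, torsion n c -> exists x, c = h x) -> (forall x, torsion n (h x)) ->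
  #|[set c : C | torsion n c]| = #|T|.
Proof.
move=> h_inj hP ht; rewrite -cardsT -(card_imset _ h_inj); congr #|pred_of_set _|.
apply/setP => c; rewrite inE; apply/idP/imsetP => [/hP[x ->]|[x _ ->] //].
by exists x.
Qed.

Lemma card_torsion_p : #|[set c : C | torsion p c]| = p.
Proof. by rewrite (card_torsion gP_inj torsion_pP torsion_gP) card_Fp. Qed.

Lemma card_torsion_3 : #|[set c : C | torsion 3 c]| = 3.
Proof. by rewrite (card_torsion gT_inj torsion_3P torsion_gT) card_Fp. Qed.

Lemma card_torsion_2 : #|[set c : C | torsion 2 c]| = 4.
Proof. by rewrite (card_torsion gV_inj torsion_2P torsion_gV) card_prod !card_Fp. Qed.

Lemma torsion_p_expg (c : C) : (c ^+ p = 1)%g -> torsion p c.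
Proof.
apply: (@torsion_of_expg _ _ (semidirect sigma) _ _ (fun s => s.1) f_inj fM _ _
  card_torsion_p); last by rewrite card_Fp.
have ord_p := semidirect_order_p p_prime p_ge7.
move=> x y /eqP/ord_p x2 /eqP/ord_p.
by case: x y x2 => a h [b k] /= -> -> ->.
Qed.

Lemma torsion_3_expg (c : C) : (c ^+ 3 = 1)%g -> torsion 3 c.
Proof.
apply: (@torsion_of_expg _ _ (semidirect sigma) _ _ (fun s => s.2.1) f_inj fM _ _
  card_torsion_3); last by rewrite card_Fp.
have ord_3 := semidirect_order3 p_prime p_ge7.
move=> x y /eqP/ord_3 x2 /eqP/ord_3.
by case: x y x2 => a [h v] [b [k w]] /= [-> ->] [-> ->] ->.
Qed.

Lemma torsion_p_normal (c y : C) : torsion p c -> torsion p (c ^ y)%g.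
Proof.
move=> tc; apply: torsion_p_expg; rewrite -conjXg.
by have := torsion_expg tc; rewrite card_torsion_p => ->; rewrite conj1g.
Qed.

Lemma torsion_3_normal (c y : C) : torsion 3 c -> torsion 3 (c ^ y)%g.
Proof.
move=> tc; apply: torsion_3_expg; rewrite -conjXg.
by have := torsion_expg tc; rewrite card_torsion_3 => ->; rewrite conj1g.
Qed.

Lemma torsion_2_involutive (c : C) : torsion 2 c -> (c * c = 1)%g.
Proof.
move=> /torsion_expg; rewrite card_torsion_2 => c4; apply: f_inj.
rewrite fM (morph_mul1 fM); apply: (semidirect_exponent4 p_prime p_ge7).
by rewrite -(morph_mulX _ _ fM) c4 (morph_mul1 fM).
Qed.

Lemma lam_gP_gT a t : lam (gP a) (gT t) = gT t.
Proof.
apply: (lam_coprime_torsion _ torsion_p_normal); last exact: torsion_gT.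
  by rewrite coprime_small_prime.
exact: torsion_gP.
Qed.

Lemma lam_gP_gV a v : lam (gP a) (gV v) = gV v.
Proof.
apply: (lam_coprime_torsion _ torsion_p_normal); last exact: torsion_gV.
  by rewrite coprime_small_prime.
exact: torsion_gP.
Qed.

Lemma lam_gT_gP t a : lam (gT t) (gP a) = gP a.
Proof.
apply: (lam_coprime_torsion _ torsion_3_normal); last exact: torsion_gP.
  by rewrite coprime_sym coprime_small_prime.
exact: torsion_gT.
Qed.

Lemma lam_gT_gV t v : lam (gT t) (gV v) = gV v.
Proof. exact: (lam_coprime_torsion _ torsion_3_normal (torsion_gT t) (torsion_gV v)). Qed.

(** [lam v v = v] because [v * v = 1 = 0] and [v + v = 0].  For another nonzero
[w], [lam v w] can only be [w] or [v + w], and the latter would give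
[v * w = v + v + w = w]. *)
Lemma lam_gV_gV v w : lam (gV v) (gV w) = gV w.
Proof.
have gV0 : gV 0%R = 0%R := morph_add0 gVD.
have vv : lam (gV v) (gV v) = gV v.
  apply: (@addrI _ (gV v)); rewrite -mul_lam torsion_2_involutive ?torsion_gV //.
  by rewrite -brace_zeroE -[RHS]mulr2n; apply/esym/eqP/torsion_gV.
have [<-|v_nw] := eqVneq v w; first exact: vv.
have [->|w_n0] := eqVneq w 0%R; first by rewrite gV0 lam0.
have [->|v_n0] := eqVneq v 0%R; first by rewrite gV0 brace_zeroE lam1.
have [u uE] := torsion_2P (torsion_lam (gV v) (torsion_gV w)).
have u_n0 : u != 0%R.
  apply: contra_neq w_n0 => u0; apply/gV_inj/(lam_inj (a := gV v)).
  by rewrite uE u0 gV0 lam0.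
have u_nv : u != v.
  apply: contra_neq v_nw => uv; apply/gV_inj/(lam_inj (a := gV v)).
  by rewrite uE uv vv.
have u_nvw : u != (v + w)%R.
  apply: contra_neq v_n0 => uvw; apply/gV_inj; rewrite gV0 brace_zeroE.
  apply: (mulIg (gV w)); rewrite mul1g mul_lam uE uvw gVD addrA -gVD.
  suff -> : (v + v)%R = 0%R :> klein by rewrite gV0 add0r.
  by have /eqP := torsion_klein v.
by rewrite uE; congr gV; apply: (klein_fourth v_nw).
Qed.

(** The trivial actions established above leave only the sign characters [kP] and
[kT] of the Klein part on the torsion of orders [p] and 3.  Written as [(-1) ^+ be]
and [(-1) ^+ al], they are brought to the normal form of a model by a change of
basis, which needs [al] to be nonzero. *)
Theorem classification : exists i : 'I_3, brace_iso C (model p i).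
Proof.
have F3P : prime 3 by [].
have [kP kPE [kPM kPp kP2]] := line_scalar p_prime gPD gP_inj torsion_pP.
have [kT kTE [kTM kT3 kT2]] := line_scalar F3P gTD gT_inj torsion_3P.
have gPp a : (gP a ^+ p)%g = 1%g.
  by have := torsion_expg (torsion_gP a); rewrite card_torsion_p.
have gT3 t : (gT t ^+ 3)%g = 1%g.
  by have := torsion_expg (torsion_gT t); rewrite card_torsion_3.
have gVV v : (gV v * gV v = 1)%g := torsion_2_involutive (torsion_gV v).
have gVM v w : gV (v + w)%R = (gV v * gV w)%g by rewrite mul_lam lam_gV_gV gVD.
have decomp m : g m = (gP m.1 * gT m.2.1 * gV m.2.2)%g.
  by rewrite gE mul_lam lamM lam_gT_gV lam_gP_gV mul_lam lam_gP_gT.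
have kPT t : kP (gT t) = 1%R.
  by apply: gP_inj; have := kPE (gT t) 1%R; rewrite lam_gT_gP mulr1.
have kTP a : kT (gP a) = 1%R.
  by apply: gT_inj; have := kTE (gP a) 1%R; rewrite lam_gP_gT mulr1.
have kPg m : kP (g m) = kP (gV m.2.2) by rewrite decomp !kPM kPp // kPT !mul1r.
have kTg m : kT (g m) = kT (gV m.2.2) by rewrite decomp !kTM kTP kT3 // !mul1r.
have lamV m v : lam (g m) (gV v) = gV v.
  by rewrite decomp !lamM lam_gV_gV lam_gT_gV lam_gP_gV.
have lam_g m n : lam (g m) (g n) =
    g ((kP (gV m.2.2) * n.1)%R, ((kT (gV m.2.2) * n.2.1)%R, n.2.2)).
  by rewrite (gE n) !lamD kPE kTE lamV kPg kTg [RHS]gE.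
have p_gt2 : 2 < p by apply: leq_trans p_ge7.
have [be beD beE] : exists2 be : klein -> 'F_2, {morph be : v w / (v + w)%R}
    & forall v, kP (gV v) = ((-1) ^+ be v)%R.
  by apply: sign_form => // [v w|v]; [rewrite gVM kPM | apply: kP2].
have [al alD alE] : exists2 al : klein -> 'F_2, {morph al : v w / (v + w)%R}
    & forall v, kT (gV v) = ((-1) ^+ al v)%R.
  by apply: sign_form => // [v w|v]; [rewrite gVM kTM | apply: kT2].
(* If [al] vanished, the elements of order 3 would be central. *)
have [v0 al_v0] : exists v0, al v0 != 0%R.
  apply/existsP; apply: contraT; rewrite negb_exists => /forallP al0.
  have [s [z [z3 []]]] := semidirect_rot_noncentral sigma.
  have [f' f'K fK] := f_bij.
  have f'M : {morph f' : x y / (x * y)%g} by move=> x y; apply: f_inj; rewrite fM !fK.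
  have [g' g'K gK] := g_bij.
  have [t tE] : exists t, f' z = gT t.
    apply/torsion_3P/torsion_3_expg; apply: f_inj.
    by rewrite (morph_mulX _ _ fM) fK z3 (morph_mul1 fM).
  have lam_gTg m : lam (gT t) (g m) = g m.
    by rewrite gE !lamD lam_gT_gP kTE kT3 // mul1r lam_gT_gV.
  have lam_ggT m : lam (g m) (gT t) = gT t.
    have /negPn/eqP := al0 m.2.2 => a0.
    by rewrite kTE kTg alE a0 expr0 mul1r.
  apply: (can_inj fK); rewrite !f'M tE -(gK (f' s)) !mul_lam lam_gTg lam_ggT.
  by rewrite addrC.
have [e [e_inj eD] [i ie]] := klein_basis alD beD al_v0.
exists i; apply: brace_iso_sym.
pose h (x : model p i) : C := g (x.1, (x.2.1, e x.2.2)).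
exists h; split.
- apply: inj_card_bij; last by rewrite -(bij_eq_card g_bij) !card_prod !card_Fp.
  by move=> [a [t v]] [b [u w]] /g_inj [-> -> /e_inj ->].
- by move=> [a [t v]] [b [u w]]; rewrite -gD /h /= eD.
move=> [a [t v]] [b [u w]]; rewrite [RHS]mul_lam /h lam_g -gD /=.
have [alv bev] := ie v.
by rewrite alE beE alv bev -!val_sgn klein_mulE eD.
Qed.

End Classification.

(** * The theorem *)

Theorem proposition17 (p : nat) (p_prime : prime p) (p_ge7 : 7 <= p) :
  let brace_class (C : finLeftBraceType) : Prop :=
    zmod_iso C ('F_p * ('Z_6 * 'Z_2))%type /\
    mulgroup_semidirect p ('D_12)%type C in
  exists B : 'I_3 -> finLeftBraceType,
    [/\ forall i, brace_class (B i),
        forall i j, brace_iso (B i) (B j) -> i = j,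
        forall C, brace_class C -> exists i, brace_iso C (B i)
      & [/\ forall i, is_direct_product p (B i) <-> i = 0 :> nat,
            forall i,
              has_kernel p (fun gT K => cyclic K /\ #|K| = 6) (B i)
                <-> i = 1 :> nat
          & forall i,
              has_kernel p (fun gT K => (K \isog 'D_6)%g) (B i)
                <-> i = 2 :> nat]].
Proof.
have cyc6 (gT : finGroupType) (K : {group gT}) :
    cyclic K /\ #|K| = 6 -> #|K| = 6 /\ abelian K = true.
  by case=> /cyclic_abelian -> ->.
have inv0 C := direct_product_invariant p_prime p_ge7 (C := C).
have inv1 C := has_kernel_invariant p_prime p_ge7 cyc6 (C := C).
have inv2 C := has_kernel_invariant p_prime p_ge7 D6_kernel_invariant (C := C).
have m0 : all_fix_torsion p (model p 0) by apply/inv0/model_direct_product.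
have [m1a m1b] := inv1 _ (model_has_cyclic_kernel p_prime p_ge7).
have [m2a m2b] := inv2 _ (model_has_D6_kernel p_prime p_ge7).
have nm1 : ~ all_fix_torsion p (model p 1) by move/m1a.
have nm2 : ~ all_fix_torsion p (model p 2) by move/m2a.
have c1 : fixators_commute p (model p 1) by apply/m1b.
have nc2 : ~ fixators_commute p (model p 2) by move/m2b.
exists (fun i => model p i); split.
- by move=> i; split; [apply: model_zmod_iso | apply: model_mulgroup].
- move=> i j isoij; have isoji := brace_iso_sym isoij; apply/val_inj; move: isoij isoji.
  have A := @all_fix_torsion_iso p; have K := @fixators_commute_iso p.
  by case: i j => [[|[|[|//]]] ?] [[|[|[|//]]] ?] //= ij ji;
    have := A _ _ ij; have := A _ _ ji; have := K _ _ ij; have := K _ _ ji; tauto.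
- move=> C [isoC [tau isoC2]].
  have [sigma isoS] := semidirect_transport tau (isog_symr isog_D12).
  have [f f_bij fM] := isog_bij (isog_trans isoC2 isoS).
  have [g0 g0_bij g0D] := zmod_iso_sym isoC.
  apply: (@classification p C p_prime p_ge7 _ (bij_comp g0_bij (pair_crt_bij p)) _
    sigma f f_bij fM) => -[a m] [b n].
  by rewrite -g0D /= crt_mapD.
split=> i.
- split=> [/inv0 | i0].
    by case: i => [[|[|[|//]]] ?] /=.
  by rewrite i0; apply: model_direct_product.
- split=> [/inv1[] | i0].
    by case: i => [[|[|[|//]]] ?] //= []; tauto.
  by rewrite i0; apply: model_has_cyclic_kernel.
split=> [/inv2[] | i0].
  by case: i => [[|[|[|//]]] ?] //= []; tauto.
by rewrite i0; apply: model_has_D6_kernel.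
Qed.
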